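(* Let $\{\mathfrak{s}_k\}_{k\in\mathbb{N}}$ be a sequence of nontrivial primitive signatures and let $T$ be a Borel automorphism of a separable metric space $(X,\rho)$. Then there exist a metrically universal $T$-invariant Borel subset $\widehat X\subset X$ consisting of $T$-aperiodic points and a basic Borel filtration $\Xi=\{\xi_k\}_{k\ge0}$ on $\widehat X$ which is a basic filtration for $T|_{\widehat X}$, such that for every $k\ge1$ the partition $\xi_k/\xi_{k-1}$ is subordinate to the signature $\mathfrak{s}_k$ (i.e. every element of $\xi_k$ is the union of exactly $m$ elements of $\xi_{k-1}$ for some $m\in\mathfrak{s}_k$).
   Context: A Borel automorphism is an invertible map with $T$ and $T^{-1}$ Borel measurable. $M_{\mathrm{ap}}(X,T)$ is the set of $T$-invariant Borel probability measures on $X$ giving measure zero to the set of $T$-periodic points; a Borel set $\widehat X$ is metrically universal if $\mu(\widehat X)=1$ for all $\mu\in M_{\mathrm{ap}}(X,T)$. A signature is a finite nonempty set of positive integers; primitive means its elements are jointly coprime; trivial means it equals $\{1\}$. A partition is subordinate to a signature $\mathfrak{s}$ if all its elements are finite with cardinality in $\mathfrak{s}$. A Borel filtration of a standard Borel space $Y$ is a decreasing (each partition coarser than the previous) sequence $\{\xi_n\}_{n\ge0}$ of Borel partitions with $\xi_0$ the partition into points. It is locally finite if for each $n$ the cardinalities of the elements of $\xi_n$ are bounded by a constant depending on $n$. It is ordered if each element of the quotient partition $\xi_{n+1}/\xi_n$ (i.e. the set of $\xi_n$-elements composing a given $\xi_{n+1}$-element) carries a linear order, measurably (the set of points whose $\xi_n$-element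 has a given position in its $\xi_{n+1}$-element is Borel); these induce coherent linear orders on the elements of each $\xi_n$. A basic filtration is a locally finite ordered Borel filtration. A basic filtration is a basic filtration for a Borel automorphism $T$ of $Y$ if every element $\alpha$ of every $\xi_k$ is of the form $\{T^jx: j=0,\dots,|\alpha|-1\}$ ordered by $j$, and for every $x$ the union over $k$ of the elements $\xi_k(x)$ containing $x$ equals the $T$-orbit of $x$. *)

(* Defs.v *)
From HB Require Import structures.
From mathcomp Require Import all_boot all_order all_algebra.
From mathcomp Require Import all_classical all_reals all_analysis.
From mathcomp Require Import Rstruct Rstruct_topology.
Set Implicit Arguments. Unset Strict Implicit. Unset Printing Implicit Defensive.
Import Order.TTheory GRing.Theory Num.Theory.
Local Open Scope classical_set_scope.
Local Open Scope card_scope.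

Notation RR := Rdefinitions.R.

(* ---------- Signatures (finite nonempty sets of positive integers, as seqs) *)
Definition signature (s : seq nat) : Prop :=
  s <> [::] /\ (forall m, m \in s -> 0 < m)%N.
Definition primitive_sig (s : seq nat) : Prop := foldr gcdn 0%N s = 1%N.
Definition trivial_sig (s : seq nat) : Prop := forall m, m \in s -> m = 1%N.

Definition separable_metric (X : pseudoPMetricType RR) : Prop :=
  hausdorff_space X /\ exists D : set X, countable D /\ closure D = setT.

Notation borel X := (g_sigma_algebraType (@open X)).


Definition borel_automorphism (X : pseudoPMetricType RR) (T Tinv : X -> X) : Prop :=
  cancel T Tinv /\ cancel Tinv T /\
  measurable_fun setT (T : borel X -> borel X) /\
  measurable_fun setT (Tinv : borel X -> borel X).

Definition periodic_pt {X : Type} (T : X -> X) (x : X) : Prop :=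
  exists n, (0 < n)%N /\ iter n T x = x.

Definition T_orbit {X : Type} (T Tinv : X -> X) (x : X) : set X :=
  [set y | exists j, y = iter j T x \/ y = iter j Tinv x].

Definition M_ap (X : pseudoPMetricType RR) (T : X -> X)
    (mu : probability (borel X) RR) : Prop :=
  (forall A : set (borel X), measurable A -> mu (T @^-1` A) = mu A) /\
  mu [set x | periodic_pt T x] = 0%E.

Definition metrically_universal (X : pseudoPMetricType RR) (T : X -> X)
    (Y : set X) : Prop :=
  measurable (Y : set (borel X)) /\
  forall mu : probability (borel X) RR, M_ap T mu -> mu Y = 1%E.

(* ---------- Partitions and filtrations of a subset Y of X.
   A partition of Y is given by the map x |-> (element containing x). *)
Definition partition_of {X : Type} (Y : set X) (P : X -> set X) : Prop :=
  forall x, Y x -> [/\ P x x, P x `<=` Y & forall y, P x y -> P y = P x].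

Definition borel_partition (X : pseudoPMetricType RR) (Y : set X)
    (P : X -> set X) : Prop :=
  partition_of Y P /\
  measurable ([set p | Y p.1 /\ P p.1 p.2] : set (borel X * borel X)%type).

Definition borel_filtration (X : pseudoPMetricType RR) (Y : set X)
    (xi : nat -> X -> set X) : Prop :=
  (forall n, borel_partition Y (xi n)) /\
  (forall x, Y x -> xi 0%N x = [set x]) /\
  (forall n x, Y x -> xi n x `<=` xi n.+1 x).

Definition locally_finite {X : Type} (Y : set X) (xi : nat -> X -> set X) : Prop :=
  forall n, exists C : nat, forall x, Y x -> xi n x #<= `I_C.

Definition quotient_elt {X : Type} (xi : nat -> X -> set X) (n : nat) (x : X)
  : set (set X) := [set xi n y | y in xi n.+1 x].

(* Ordered filtration: pos n x is the position (0,...,m-1) of the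
   xi n-element of x inside its xi n.+1-element (which consists of m
   xi n-elements); these positions determine a linear order, and the set of
   points whose xi n-element has a given position is Borel. *)
Definition ordering (X : pseudoPMetricType RR) (Y : set X)
    (xi : nat -> X -> set X) (pos : nat -> X -> nat) : Prop :=
  forall n,
  [/\ forall x y, Y x -> xi n x y -> pos n y = pos n x,
      forall x y z, Y x -> xi n.+1 x y -> xi n.+1 x z ->
        pos n y = pos n z -> xi n y = xi n z,
      forall x, Y x -> exists m, quotient_elt xi n x #= `I_m /\
        forall y, xi n.+1 x y -> (pos n y < m)%N
    & forall i, measurable ([set x | Y x /\ pos n x = i] : set (borel X))].

Definition basic_filtration (X : pseudoPMetricType RR) (Y : set X)
    (xi : nat -> X -> set X) (pos : nat -> X -> nat) : Prop :=
  [/\ borel_filtration Y xi, locally_finite Y xi & ordering Y xi pos].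

(* induced (coherent) strict linear order on the elements of xi k:
   y < z iff at the largest level n < k where their xi n-elements differ,
   the xi n-element of y precedes that of z *)
Definition induced_lt {X : Type} (pos : nat -> X -> nat) (k : nat) (y z : X)
  : Prop :=
  exists2 n, (n < k)%N &
    (pos n y < pos n z)%N /\ forall j, (n < j < k)%N -> pos j y = pos j z.

Definition basic_filtration_for (X : pseudoPMetricType RR) (Y : set X)
    (T Tinv : X -> X) (xi : nat -> X -> set X) (pos : nat -> X -> nat) : Prop :=
  basic_filtration Y xi pos /\
  (forall k x, Y x -> exists a N,
      xi k x = [set iter j T a | j in `I_N] /\
      forall i j, (i < j < N)%N -> induced_lt pos k (iter i T a) (iter j T a)) /\
  (forall x, Y x -> \bigcup_k xi k x = T_orbit T Tinv x).

Definition subordinate {X : Type} (Y : set X) (xi : nat -> X -> set X)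
    (k : nat) (s : seq nat) : Prop :=
  forall x, Y x -> exists2 m, m \in s & quotient_elt xi k.-1 x #= `I_m.

(* Main.v *)
Require Import Defs.
From HB Require Import structures.
From mathcomp Require Import all_boot all_order all_algebra.
From mathcomp Require Import all_classical all_reals all_analysis.
From mathcomp Require Import Rstruct Rstruct_topology.
From mathcomp Require Import zify lra.
Set Implicit Arguments. Unset Strict Implicit. Unset Printing Implicit Defensive.
Import Order.TTheory GRing.Theory Num.Theory.
Import numFieldNormedType.Exports.
Local Open Scope classical_set_scope.
Local Open Scope card_scope.

(** The left ends of the blocks of level [k] form a Borel set [B k], starting
    with the aperiodic points; [S k] is the map induced by [T] on [B k], made
    total by the identity outside [B k].  Given [B k], a Borel marker set [M]
    whose [S k]-gaps are long cuts each orbit into finite stretches.  As the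
    signature is primitive, every long enough stretch is tiled by tiles with
    lengths in the signature, using one fixed tile of length [> 1] except on a
    bounded initial part, and [B k.+1] consists of the starts of the tiles.
    Away from the sparse set [M] a point of [B k.+1] is followed by a point of
    [B k] outside [B k.+1], so [mu (B k.+1) <= 3/4 mu (B k)] for every invariant
    probability [mu].  Hence the intersection of the [B k] is null; off its orbit
    saturation neither end of the block of a point can stabilize, so the blocks
    exhaust the orbit. *)

(** * Tilings *)

(** The left ends of the tiles when tiles of the positive lengths listed in [l] are laid side by
    side from 0. The right end [sumn l] is left out: it opens the next stretch. *)
Fixpoint starts (l : seq nat) (i : nat) : bool :=
  if l is r :: l' then (i == 0)%N || ((r <= i)%N && starts l' (i - r)) else false.

Lemma starts0 l : (0 < sumn l)%N -> starts l 0.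
Proof. by case: l. Qed.

(** Combinatorial form of [returns_in]. The third clause is conditional because the last tile ends
    at [sumn l], which is not a start. *)
Lemma starts_next l i : (forall r, r \in l -> (0 < r)%N) -> starts l i ->
  exists r, [/\ r \in l, (i + r <= sumn l)%N,
    (i + r < sumn l)%N -> starts l (i + r)
    & forall j, (0 < j < r)%N -> ~~ starts l (i + j)].
Proof.
elim: l i => //= a l IH i hl; case: eqP => [-> _ | /eqP i0 /= /andP[ai hi]].
  exists a; split; first by rewrite mem_head.
  - by lia.
  - rewrite add0n leqnn subnn => h; apply/orP; right => /=; apply: starts0; lia.
  - by move=> j; rewrite add0n => hj; apply/negP => /orP[|/andP[]]; lia.
have [|r [rl h1 h2 h3]] := IH _ _ hi.
  by move=> r rl; apply: hl; rewrite inE rl orbT.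
exists r; split.
- by rewrite inE rl orbT.
- by lia.
- move=> h; apply/orP; right; apply/andP; split; first lia.
  have -> : (i + r - a = i - a + r)%N by lia.
  by apply: h2; lia.
- move=> j hj; apply/negP => /orP[|/andP[_]]; first lia.
  have -> : (i + j - a = i - a + j)%N by lia.
  by apply/negP; apply: h3.
Qed.

Lemma starts_cat l1 l2 i : starts (l1 ++ l2) i =
  starts l1 i || ((sumn l1 <= i)%N && starts l2 (i - sumn l1)).
Proof.
elim: l1 i => [|a l1 IH] i /=; first by rewrite subn0.
rewrite IH -orbA; congr (_ || _).
case: (leqP a i) => h /=; last by have -> : (a + sumn l1 <= i)%N = false by lia.
by rewrite subnDA leq_subRL.
Qed.

Lemma starts_lt l i : (forall r, r \in l -> (0 < r)%N) -> starts l i ->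
  (i < sumn l)%N.
Proof.
move=> hl /(starts_next hl)[r [rl h _ _]]; have := hl _ rl; lia.
Qed.

Lemma starts_nseq_succ q p i : (1 < p)%N -> starts (nseq q p) i ->
  (i.+1 < sumn (nseq q p))%N && ~~ starts (nseq q p) i.+1.
Proof.
move=> p1 hi.
have hp r : r \in nseq q p -> r = p by rewrite mem_nseq => /andP[_ /eqP].
have [|r [/hp -> h1 _ h3]] := starts_next _ hi; first by move=> r /hp ->; lia.
have := h3 1%N; rewrite addn1 => -> /=; lia.
Qed.

Lemma sumn_flatten_nseq k (w : seq nat) : sumn (flatten (nseq k w)) = (k * sumn w)%N.
Proof. by elim: k => //= k IH; rewrite sumn_cat IH mulSn. Qed.

Lemma mem_flatten_nseq k (w : seq nat) x : x \in flatten (nseq k w) -> x \in w.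
Proof. by elim: k => //= k IH; rewrite mem_cat => /orP[|]. Qed.

(* Bezout, with negative multiples removed by working modulo [p]. *)
Lemma sumn_eq_gcd_mod s p : (0 < p)%N -> (forall m, m \in s -> (0 < m)%N) ->
  exists2 w, {subset w <= s} & sumn w = foldr gcdn 0%N s %[mod p].
Proof.
move=> p0; elim: s => [|a s IH] hs; first by exists [::].
have [|w ws hw] := IH; first by move=> m ms; apply: hs; rewrite inE ms orbT.
have a0 : (0 < a)%N by apply: hs; rewrite mem_head.
rewrite /=; set g := foldr _ _ _ in hw *.
case: (egcdnP g a0) => u v e _.
(* [e] reads [u * a = v * g + gcdn a g]; modulo [p] the copies of [w] add [v * p.-1 * g], which
   completes [v * g] to a multiple of [p]. *)
exists (nseq u a ++ flatten (nseq (v * p.-1) w)).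
  move=> x; rewrite mem_cat mem_nseq inE => /orP[/andP[_ ->]//|/mem_flatten_nseq/ws ->].
  by rewrite orbT.
rewrite sumn_cat sumn_nseq sumn_flatten_nseq mulnC e -modnDmr -modnMmr hw modnMmr modnDmr.
have -> : (v * g + gcdn a g + v * p.-1 * g = gcdn a g + (v * g) * p)%N.
  by case: p p0 {IH hw} => // p _ /=; lia.
by rewrite addnC modnMDl.
Qed.

(** By primitivity some [w] has sum 1 modulo [p]. Fewer than [p] copies of [w] leave a length
    divisible by [p], filled with tiles [p]. Past [K = p * sumn w] only these tiles start, so no two
    starts are adjacent; [i.+1 < L] also keeps [i.+1] off the start of the next stretch. *)
Lemma tiling_exists s p : signature s -> primitive_sig s -> p \in s -> (1 < p)%N ->
  exists K : nat, forall L, (K < L)%N -> exists l, [/\ {subset l <= s}, sumn l = L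
    & forall i, (K <= i)%N -> starts l i -> (i.+1 < L)%N && ~~ starts l i.+1].
Proof.
move=> [_ s0] s1 ps p1; have p0 : (0 < p)%N by lia.
have [w ws hw] := sumn_eq_gcd_mod p0 s0; rewrite s1 in hw.
exists (p * sumn w)%N => L hL.
pose c := (L %% p)%N; have hc : (c < p)%N by rewrite ltn_mod.
have cw : (c * sumn w <= p * sumn w)%N by rewrite leq_mul2r ltnW ?orbT.
have dv : (p %| L - c * sumn w)%N.
  rewrite -eqn_mod_dvd; last lia.
  by rewrite -modnMmr hw modnMmr muln1 /c modn_mod.
exists (flatten (nseq c w) ++ nseq ((L - c * sumn w) %/ p) p); split.
- move=> x; rewrite mem_cat mem_nseq => /orP[/mem_flatten_nseq/ws //|/andP[_ /eqP ->//]].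
- rewrite sumn_cat sumn_flatten_nseq sumn_nseq (mulnC p) divnK //; lia.
- move=> i hi; rewrite !starts_cat sumn_flatten_nseq.
  have nlt j : (p * sumn w <= j)%N -> starts (flatten (nseq c w)) j = false.
    move=> hj; apply/negP => /starts_lt; rewrite sumn_flatten_nseq => h.
    by have := h (fun r hr => s0 r (ws r (mem_flatten_nseq hr))); lia.
  rewrite !nlt ?(leqW hi) //= => /andP[h1 /(starts_nseq_succ p1)/andP[h2 h3]].
  have -> : (i.+1 - c * sumn w = (i - c * sumn w).+1)%N by lia.
  rewrite (negbTE h3) andbF andbT.
  move: h2; rewrite sumn_nseq (mulnC p) divnK //; lia.
Qed.

(** * Marker sets *)

Lemma can_iter (A : Type) (f g : A -> A) n : cancel f g -> cancel (iter n f) (iter n g).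
Proof. by move=> fK; elim: n => // n IH x; rewrite iterSr /= fK IH. Qed.

Lemma can_iter_sub (A : Type) (f g : A -> A) i j x : cancel f g -> (i <= j)%N ->
  iter i g (iter j f x) = iter (j - i) f x.
Proof. by move=> fK ij; rewrite -{1}(subnKC ij) iterD can_iter. Qed.

Lemma ex_least (P : nat -> Prop) : (exists n, P n) ->
  exists n, P n /\ forall m, (m < n)%N -> ~ P m.
Proof.
move=> [n Pn]; have h : exists n, `[<P n>] by exists n; apply/asboolP.
case: (ex_minnP h) => m /asboolP Pm hm; exists m; split=> // k km Pk.
by have := hm k (asboolT Pk); lia.
Qed.

Section Measurability.
Context {d : measure_display} {Z : measurableType d}.
Implicit Types (A B M : set Z) (f S Si : Z -> Z) (P : nat -> Z -> Prop).

Lemma measurable_preimage f A : measurable_fun setT f -> measurable A ->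
  measurable (f @^-1` A).
Proof. by move=> mf mA; rewrite -[X in measurable X]setTI; exact: mf. Qed.

Lemma measurable_iter f n : measurable_fun setT f -> measurable_fun setT (iter n f).
Proof.
move=> mf; elim: n => [|n IH]; first exact: measurable_id.
exact: (measurableT_comp mf IH).
Qed.

Lemma measurable_ex P : (forall j, measurable [set x | P j x]) ->
  measurable [set x | exists j, P j x].
Proof.
move=> h; rewrite (_ : [set x | _] = \bigcup_j [set x | P j x]).
  exact: bigcupT_measurable.
by apply/seteqP; split => x /= [j]; [exists j | move=> _; exists j].
Qed.

Lemma measurable_all P : (forall j, measurable [set x | P j x]) ->
  measurable [set x | forall j, P j x].
Proof.
move=> h; rewrite (_ : [set x | _] = \bigcap_j [set x | P j x]).
  exact: bigcapT_measurable.
by apply/seteqP; split => x /= hx j; [move=> _; exact: hx | exact: (hx j I)].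
Qed.

Lemma measurable_imp (P : Prop) A : measurable A -> measurable [set x | P -> A x].
Proof.
move=> mA; have [p|np] := pselect P.
  by rewrite (_ : [set x | _] = A)//; apply/seteqP; split => x /=; auto.
by rewrite (_ : [set x | _] = setT)//; apply/seteqP; split => // x _ /np.
Qed.

Lemma measurable_andP (P : Prop) A : measurable A -> measurable [set x | P /\ A x].
Proof.
move=> mA; have [p|np] := pselect P.
  by rewrite (_ : [set x | _] = A)//; apply/seteqP; split => x //= [].
by rewrite (_ : [set x | _] = set0)//; apply/seteqP; split => x //= [].
Qed.

(** [S] and [Si] act on the whole of [Z], so that measurability is stated on [setT]; stability and
    freeness concern [B] alone. *)
Record system B S Si : Prop := System {
  system_measurable : measurable B;
  systemK : cancel S Si;
  systemVK : cancel Si S;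
  system_fun : measurable_fun setT S;
  system_funV : measurable_fun setT Si;
  system_stable : forall x, B x -> B (S x);
  system_stableV : forall x, B x -> B (Si x);
  system_free : forall n x, B x -> iter n.+1 S x <> x }.

Lemma systemC B S Si : system B S Si -> system B Si S.
Proof.
move=> [mB SK SiK mS mSi BS BSi free]; split => // n x Bx h.
by apply: (free n x Bx); rewrite -{1}h can_iter.
Qed.

Lemma system_iter B S Si n x : system B S Si -> B x -> B (iter n S x).
Proof. by move=> sys Bx; elim: n => //= n; exact: (system_stable sys). Qed.

(** Separation from finitely many points at once lets [marker_exists] separate a point from its next
    [n] iterates. The metric of the space serves only to produce such a family. *)
Definition separating (V : nat -> set Z) : Prop :=
  (forall i, measurable (V i)) /\
  forall x n (f : nat -> Z), (forall j, (j < n)%N -> f j <> x) ->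
    exists i, V i x /\ forall j, (j < n)%N -> ~ V i (f j).

(* Greedy choice: [U i] meets none of its first [n] translates, and the [i]-th
   stage adds the points of [U i] that are not within [n] of the earlier stages. *)
Lemma marker_exists B S Si V n : system B S Si -> separating V ->
  exists M, [/\ measurable M, M `<=` B,
    forall x j, M x -> (0 < j <= n)%N -> ~ M (iter j S x),
    forall x, B x -> exists j, M (iter j.+1 S x)
    & forall x, B x -> exists j, M (iter j Si x)].
Proof.
move=> sys [mV sepV]; have [mB SK SiK mS mSi BS BSi free] := sys.
pose U i := B `&` (V i `&` [set x | forall j, (j < n)%N -> ~ V i (iter j.+1 S x)]).
pose far A := [set x | forall j, (j <= n)%N -> ~ A (iter j S x) /\ ~ A (iter j Si x)].
pose C := fix C i := if i is i'.+1 then C i' `|` (U i' `&` far (C i')) else set0.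
have mU i : measurable (U i).
  apply: measurableI => //; apply: measurableI => //.
  apply: measurable_all => j; apply: (@measurable_imp (j < n)%N (~` _)).
  apply: measurableC; exact: (measurable_preimage (measurable_iter j.+1 mS)).
have mfar A : measurable A -> measurable (far A).
  move=> mA; apply: measurable_all => j; apply: (@measurable_imp (j <= n)%N (_ `&` _)).
  apply: measurableI; apply: measurableC; apply: measurable_preimage => //;
    exact: measurable_iter.
have mC i : measurable (C i).
  elim: i => [|i IH] /=; first exact: measurable0.
  by apply: measurableU => //; apply: measurableI => //; apply: mfar.
have CB i : C i `<=` B.
  by elim: i => [|i IH] x //= [/IH//|[[]]].
have Cmono i k : (i <= k)%N -> C i `<=` C k.
  move=> /subnKC <-; elim: (k - i)%N => [|m IH] x; first by rewrite addn0.
  by move=> /IH h; rewrite addnS; left.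
have Cdisc i x j : (0 < j <= n)%N -> C i x -> ~ C i (iter j S x).
  (* Two old points are handled by induction, an old and a new one by [far] in one of its two
     directions, two new ones by the definition of [U i]. *)
  move=> /andP[j0 jn]; elim: i => [|i IH] //= [Cx|[[_ [Vx nV]] fx]] [Cy|[[_ [Vy _]] fy]].
  - exact: IH.
  - by have [_] := fy j jn; rewrite can_iter.
  - by have [] := fx j jn.
  - by apply: (nV j.-1); rewrite ?prednK //; case: j {j0 Cmono IH} jn Vy.
have Ccov x : B x -> exists i j, (j <= n)%N /\ (C i (iter j S x) \/ C i (iter j Si x)).
  move=> Bx; have [|i [Vx nV]] := sepV x n (fun j => iter j.+1 S x).
    by move=> j _; apply: free.
  have [fx|] := pselect (far (C i) x); first by exists i.+1, 0%N; split=> //; left; right.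
  move=> /existsNP[j /not_implyP[jn /not_andP[]/contrapT h]].
    by exists i, j; split=> //; left.
  by exists i, j; split=> //; right.
have cov x : B x -> exists j, (j <= n)%N /\
    ((\bigcup_i C i) (iter j S x) \/ (\bigcup_i C i) (iter j Si x)).
  move=> /Ccov[i [j [jn [h|h]]]]; exists j; split=> //.
    by left; exists i.
  by right; exists i.
exists (\bigcup_i C i); split.
- exact: bigcupT_measurable.
- by move=> x [i _ /CB].
- move=> x j [a _ Ca] jn [b _ Cb].
  exact: (Cdisc (maxn a b) x j jn (Cmono _ _ (leq_maxl a b) _ Ca)
    (Cmono _ _ (leq_maxr a b) _ Cb)).
(* [cov] finds a marker within [n] on an unknown side. Applied [n.+1] steps ahead it gives one
   strictly after [x]; applied [n] steps back, one at or before [x]. *)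
- move=> x Bx; have [|j [jn [h|h]]] := cov (iter n.+1 S x).
    exact: system_iter sys Bx.
  + by exists (j + n)%N; rewrite -addnS iterD.
  + exists (n - j)%N; move: h; rewrite can_iter_sub //; last lia.
    by rewrite subSn.
- move=> x Bx; have [|j [jn [h|h]]] := cov (iter n Si x).
    exact: system_iter (systemC sys) Bx.
  + by exists (n - j)%N; move: h; rewrite can_iter_sub.
  + by exists (j + n)%N; rewrite iterD.
Qed.

End Measurability.

(** * Thinning a marker set *)

Section Thinning.
Context {d : measure_display} {Z : measurableType d}.
Implicit Types (A B M : set Z) (S Si : Z -> Z) (V : nat -> set Z).

Definition returns_in (s : seq nat) B S : Prop := forall x, B x ->
  exists r, [/\ r \in s, (0 < r)%N, B (iter r S x)
    & forall j, (0 < j < r)%N -> ~ B (iter j S x)].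

(* Away from the sparse set [M] no two consecutive points lie in [B'], so the
   density of [B'] in [B] is at most [3/4]. *)
Definition sparse B B' S Si : Prop := exists M K,
  [/\ measurable M, M `<=` B,
    forall x j, M x -> (0 < j <= K.*2)%N -> ~ M (iter j S x)
    & forall x, B' x -> ~ B' (S x) \/ exists i, (i < K)%N /\ M (iter i Si x)].

(** Consecutive markers bound stretches, each tiled by a list that depends on its length only. Hence
    [B'] is a countable union of preimages of Borel sets under powers of [Si], and its return times
    are tile lengths. *)
Lemma thinning_exists B S Si V s : system B S Si -> separating V ->
  signature s -> primitive_sig s -> ~ trivial_sig s ->
  exists B', [/\ measurable B', B' `<=` B, returns_in s B' S,
    forall x, B x -> exists i, B' (iter i Si x) & sparse B B' S Si].
Proof.
move=> sys sepV s0 s1 /existsNP[p /not_implyP[ps /eqP p1]].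
have {}p1 : (1 < p)%N by move: (s0.2 p ps) => h; lia.
have [K tileK] := tiling_exists s0 s1 ps p1.
(* The tiling asks for gaps longer than [K]; the factor two makes the points less than [K] past a
   marker at most half of [B] in measure. *)
have [M [mM MB Mdisc Mfwd Mbwd]] := marker_exists K.*2 sys sepV.
have [mB SK SiK mS mSi BS BSi free] := sys.
(* One tiling is fixed for each length; for [L <= K] the list is unconstrained. *)
have /choice[tl tlP] : forall L, exists l, (K < L)%N -> [/\ {subset l <= s}, sumn l = L
    & forall i, (K <= i)%N -> starts l i -> (i.+1 < L)%N && ~~ starts l i.+1].
  move=> L; have [/tileK[l hl]|nL] := pselect (K < L)%N; first by exists l.
  by exists [::].
pose gap L := [set y | [/\ M y, M (iter L S y) &
  forall j, (0 < j < L)%N -> ~ M (iter j S y)]].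
have gapK L y : (0 < L)%N -> gap L y -> (K.*2 < L)%N.
  by move=> L0 [My ML _]; rewrite ltnNge; apply/negP => hL; apply: (Mdisc y L) ML; rewrite ?L0.
have gap_exists y : M y -> exists L, (0 < L)%N /\ gap L y.
  move=> My; have [j [Mj hj]] := ex_least (Mfwd y (MB _ My)).
  exists j.+1; split=> //; split=> // -[//|k] hk; apply: hj; lia.
(* A point has one stretch and one offset: if [i < i'], then [y] would be a marker strictly inside
   the stretch that starts at [y']. *)
have gap_uniq L L' i i' y y' : gap L y -> gap L' y' -> (i < L)%N -> (i' < L')%N ->
    iter i S y = iter i' S y' -> i = i' /\ L = L'.
  wlog ii' : L L' i i' y y' / (i <= i')%N.
    move=> H g g' iL iL' e; have [h|h] := leqP i i'; first exact: (H _ _ _ _ y y').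
    by have [] := H L' L i' i y' y (ltnW h) g' g iL' iL (esym e).
  move=> g g' iL iL' e; have ey : y = iter (i' - i) S y'.
    by rewrite -(can_iter_sub _ SK ii') -e can_iter.
  have ei : i = i'.
    apply/eqP; rewrite eqn_leq ii' /= leqNgt; apply/negP => lii'.
    by case: g' => _ _ /(_ (i' - i)%N); rewrite -ey => h; apply: h; [lia | case: g].
  split=> //; move: ey; rewrite ei subnn /= => ey.
  move: g; rewrite ey => -[_ ML hL]; case: g' => _ ML' hL'.
  have [h|h|//] := ltngtP L L'.
    by exfalso; apply: (hL' L) ML; lia.
  by exfalso; apply: (hL L') ML'; lia.
pose B' := [set x | exists L, exists i, ((i < L)%N && starts (tl L) i) /\ gap L (iter i Si x)].
have B'E L i y : gap L y -> (i < L)%N -> B' (iter i S y) <-> starts (tl L) i.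
  move=> g iL; split.
    move=> [L' [i' [/andP[iL' st] g']]].
    by have [|||-> ->] := gap_uniq _ _ i i' _ _ g g' => //; rewrite can_iter.
  by move=> st; exists L, i; rewrite iL st can_iter.
have MB' y : M y -> B' y.
  move=> /gap_exists[L [L0 g]]; apply/(B'E L 0%N y g L0)/starts0.
  by have [|_ -> _ //] := tlP L; have := gapK _ _ L0 g; lia.
have B'P x : B' x -> exists L i y, [/\ x = iter i S y, (i < L)%N, gap L y,
    starts (tl L) i & (K.*2 < L)%N].
  move=> [L [i [/andP[iL st] g]]]; exists L, i, (iter i Si x); split=> //.
    by rewrite can_iter.
  by apply: gapK g; lia.
exists B'; split.
- apply: measurable_ex => L; apply: measurable_ex => i.
  apply: measurable_andP; apply: (@measurable_preimage _ _ _ (gap L)).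
    exact: measurable_iter.
  rewrite (_ : gap L = M `&` ([set y | M (iter L S y)] `&`
    [set y | forall j, (0 < j < L)%N -> ~ M (iter j S y)])); last first.
    by apply/seteqP; split=> y /=; [case | case=> ? []].
  apply: measurableI => //; apply: measurableI.
    exact: (measurable_preimage (measurable_iter L mS)).
  apply: measurable_all => j; apply: (@measurable_imp _ _ _ (~` _)).
  apply: measurableC; exact: (measurable_preimage (measurable_iter j mS)).
- move=> x /B'P[L [i [y [-> _ [My _ _] _ _]]]].
  exact: (system_iter _ sys (MB _ My)).
- move=> x /B'P[L [i [y [-> iL g st KL]]]].
  have [|tls tlL _] := tlP L; first by lia.
  have [|r [rl h1 h2 h3]] := starts_next _ st.
    by move=> r /tls rs; apply: s0.2.
  rewrite tlL in h1 h2; exists r; split.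
  - exact: tls.
  - exact: (s0.2 _ (tls _ rl)).
  (* The next tile starts in the same stretch or exactly at the next marker, which lies in [B'] as
     well. *)
  - rewrite -iterD addnC; have [irL|irL] := ltnP (i + r) L.
      by apply/(B'E L) => //; apply: h2.
    have -> : (i + r = L)%N by lia.
    by apply: MB'; case: g.
  - move=> j hj; rewrite -iterD addnC => /(B'E L (i + j)%N y g) h.
  by apply: (negP (h3 j hj)); apply: h; lia.
- by move=> x /Mbwd[i Mi]; exists i; apply: MB'.
- exists M, K; split=> // x /B'P[L [i [y [-> iL g st KL]]]].
  have [iK|iK] := ltnP i K.
    by right; exists i; rewrite can_iter //; case: g.
  have [|_ _ /(_ i iK st)/andP[iL' nst]] := tlP L; first by lia.
  left; rewrite -iterS => /(B'E L i.+1 y g iL').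
  exact/negP.
Qed.

End Thinning.

(** * Induced maps *)

(* Junk value: [first P = 0] when [P] holds nowhere. *)
Definition first (P : nat -> Prop) : nat :=
  xget 0%N [set n | P n /\ forall m, (m < n)%N -> ~ P m].

Lemma firstP (P : nat -> Prop) : (exists n, P n) ->
  P (first P) /\ forall m, (m < first P)%N -> ~ P m.
Proof. by move=> /ex_least h; apply: (xgetPex 0%N h). Qed.

Lemma first_eq (P : nat -> Prop) n : P n -> (forall m, (m < n)%N -> ~ P m) ->
  first P = n.
Proof.
move=> Pn hn; have [Pf hf] := firstP (ex_intro _ n Pn).
have [h|h|//] := ltngtP (first P) n; first by case: (hn _ h).
by case: (hf _ h).
Qed.

(** The shift by one makes return times positive. The identity outside [B] keeps the map invertible
    on all of [Z] when points of [B] return in both directions. *)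
Definition induced (Z : Type) (S : Z -> Z) (B : set Z) (x : Z) : Z :=
  if `[<B x>] then iter (first (fun n => B (iter n.+1 S x))).+1 S x else x.

Section Induced.
Context {d : measure_display} {Z : measurableType d}.
Implicit Types (A B M : set Z) (S Si : Z -> Z).

Lemma measurable_first (P : nat -> Z -> Prop) n :
  (forall n, measurable [set x | P n x]) ->
  measurable [set x | first (P^~ x) = n].
Proof.
move=> mP; have mlt k : measurable [set x | forall m, (m < k)%N -> ~ P m x].
  apply: measurable_all => m; apply: (@measurable_imp _ _ _ (~` [set x | P m x])).
  exact: measurableC.
(* The second set accounts for the default value 0, taken where [P] never holds. *)
rewrite (_ : [set x | _] = ([set x | P n x] `&` [set x | forall m, (m < n)%N -> ~ P m x])
   `|` [set x | n = 0%N /\ forall m, ~ P m x]).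
  apply: measurableU; first exact: measurableI.
  apply: (@measurable_andP _ _ _ [set x | forall m, ~ P m x]).
  apply: measurable_all => m; exact: (measurableC (mP m)).
apply/seteqP; split => x /=.
  move=> <-; have [ex|nex] := pselect (exists m, P m x).
    by left; apply: (firstP ex).
  right; split; last by move=> m Pm; apply: nex; exists m.
  by apply: xgetPN => m [Pm _]; apply: nex; exists m.
move=> [[Pn hn]|[-> hn]]; first exact: first_eq.
by apply: xgetPN => m [/hn].
Qed.

Lemma measurable_pieces (f : Z -> Z) (E : nat -> set Z) (g : nat -> Z -> Z) :
  (forall n, measurable (E n)) -> (forall n, measurable_fun setT (g n)) ->
  (forall x, exists n, E n x) -> (forall n x, E n x -> f x = g n x) ->
  measurable_fun setT f.
Proof.
move=> mE mg covE fg _ A mA; rewrite setTI.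
rewrite (_ : f @^-1` A = \bigcup_n (E n `&` g n @^-1` A)).
  apply: bigcupT_measurable => n; apply: measurableI => //.
  exact: measurable_preimage.
apply/seteqP; split => x /=.
  by move=> Afx; have [n En] := covE x; exists n => //; split=> //=; rewrite -(fg n).
by move=> [n _ [En]] /=; rewrite -(fg n).
Qed.

(** The partition by return time; the index 0, which is no return time, is given to the complement
    of [B]. *)
Definition piece S B n : set Z :=
  if n is n'.+1 then [set x | B x /\ first (fun m => B (iter m.+1 S x)) = n'] else ~` B.

Lemma measurable_piece S B n : measurable_fun setT S -> measurable B ->
  measurable (piece S B n).
Proof.
move=> mS mB; case: n => [|n] /=; first exact: measurableC.
apply: measurableI => //; apply: measurable_first => m.
exact: (measurable_preimage (measurable_iter m.+1 mS)).
Qed.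

Lemma piece_cover S B x : exists n, piece S B n x.
Proof.
have [Bx|nBx] := pselect (B x); last by exists 0%N.
by exists (first (fun m => B (iter m.+1 S x))).+1.
Qed.

Lemma piece_inj S B x n m : piece S B n x -> piece S B m x -> n = m.
Proof.
by case: n m => [|n] [|m] //=; [move=> h [] | move=> [] ? _ h | move=> [_ <-] [_ <-]].
Qed.

Lemma induced_piece S B x n : piece S B n x -> induced S B x = iter n S x.
Proof.
case: n => [|n] /= h; rewrite /induced.
  by case: asboolP.
by case: asboolP => [|/(_ h.1)//]; rewrite h.2.
Qed.

Lemma measurable_induced S B : measurable_fun setT S -> measurable B ->
  measurable_fun setT (induced S B).
Proof.
move=> mS mB; apply: (@measurable_pieces _ (piece S B) (fun n => iter n S)).
- by move=> n; apply: measurable_piece.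
- by move=> n; apply: measurable_iter.
- exact: piece_cover.
- by move=> n x; apply: induced_piece.
Qed.

(** Read backwards, a first return is a first return of [Si] with the same time, since the points in
    between are the same. *)
Lemma pieceV S Si B x n : cancel S Si -> (forall x, B x -> exists n, B (iter n.+1 S x)) ->
  piece S B n x -> piece Si B n (iter n S x).
Proof.
move=> SK rec; case: n => [//|n] [Bx fx].
have [Bf hf] := firstP (rec x Bx); rewrite fx in Bf hf.
split=> //; apply: first_eq; first by rewrite can_iter.
move=> m mn; rewrite can_iter_sub //; last lia.
have -> : (n.+1 - m.+1 = (n - m.+1).+1)%N by lia.
apply: hf; lia.
Qed.

Lemma induced_can S Si B : cancel S Si ->
  (forall x, B x -> exists n, B (iter n.+1 S x)) ->
  cancel (induced S B) (induced Si B).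
Proof.
move=> SK rec x; have [n px] := piece_cover S B x.
by rewrite (induced_piece px) (induced_piece (pieceV SK rec px)) can_iter.
Qed.

Lemma induced_stable S B x : (forall x, B x -> exists n, B (iter n.+1 S x)) ->
  B x -> B (induced S B x).
Proof.
by move=> rec Bx; rewrite /induced asboolT //; have [] := firstP (rec x Bx).
Qed.

(** The bound [n <= m] turns a positive iterate of the induced map into a positive iterate of [S];
    this carries freeness over to the induced system. *)
Lemma induced_iter S B n x : (forall x, B x -> exists n, B (iter n.+1 S x)) -> B x ->
  exists m, (n <= m)%N /\ iter n (induced S B) x = iter m S x.
Proof.
move=> rec Bx; elim: n => [|n [m [nm e]]]; first by exists 0%N.
have Bn : B (iter n (induced S B) x).
  by elim: (n) => //= k; apply: induced_stable.
rewrite iterS {1}/induced asboolT // e -iterD.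
by eexists; split; last reflexivity; lia.
Qed.

Lemma induced_system B S Si B' : system B S Si -> measurable B' -> B' `<=` B ->
  (forall x, B' x -> exists n, B' (iter n.+1 S x)) ->
  (forall x, B' x -> exists n, B' (iter n.+1 Si x)) ->
  system B' (induced S B') (induced Si B').
Proof.
move=> [mB SK SiK mS mSi BS BSi free] mB' BB rec recV; split=> //.
- exact: induced_can.
- exact: induced_can.
- exact: measurable_induced.
- exact: measurable_induced.
- by move=> x; apply: induced_stable.
- by move=> x; apply: induced_stable.
- move=> n x Bx; have [[|m] [//= _ ->]] := induced_iter n.+1 rec Bx.
  exact: (free m x (BB _ Bx)).
Qed.

(** * Invariant measures and induced maps *)

Definition preserves {R : realType} (mu : {measure set Z -> \bar R}%R) S : Prop :=
  forall A, measurable A -> mu (S @^-1` A) = mu A.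

Lemma preserves_iter {R : realType} (mu : {measure set Z -> \bar R}%R) S n :
  measurable_fun setT S -> preserves mu S -> preserves mu (iter n S).
Proof.
move=> mS muS; elim: n => [//|n IH] A mA.
by rewrite -(muS A mA) -(IH (S @^-1` A)) //; apply: measurable_preimage.
Qed.

Lemma preservesV {R : realType} (mu : {measure set Z -> \bar R}%R) S Si :
  cancel S Si -> measurable_fun setT Si -> preserves mu S -> preserves mu Si.
Proof.
move=> SK mSi muS A mA; rewrite -muS; last exact: measurable_preimage.
by congr (mu _); apply/seteqP; split=> x /=; rewrite SK.
Qed.

(** The preimage of [A] is cut along the pieces of [S], and [A] along those of [Si]. By [pieceV] the
    [n]-th parts correspond under [iter n S], so they have equal measure, and countable additivity
    concludes. *)
Lemma preserves_induced {R : realType} (mu : {measure set Z -> \bar R}%R) B S Si B' :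
  system B S Si -> measurable B' ->
  (forall x, B' x -> exists n, B' (iter n.+1 S x)) ->
  (forall x, B' x -> exists n, B' (iter n.+1 Si x)) ->
  preserves mu S -> preserves mu (induced S B').
Proof.
move=> [mB SK SiK mS mSi _ _ _] mB' rec recV muS A mA.
have triv S' (F : nat -> set Z) : trivIset setT (fun n => piece S' B' n `&` F n).
  by move=> i j _ _ [x [[pi _] [pj _]]]; apply: piece_inj pi pj.
have mp n : measurable (piece Si B' n `&` A).
  by apply: measurableI => //; apply: measurable_piece.
have eq n : piece S B' n `&` (iter n S @^-1` A) = iter n S @^-1` (piece Si B' n `&` A).
  apply/seteqP; split=> x [px Ax]; split=> //; first exact: pieceV px.
  by rewrite -(can_iter n SK x); apply: pieceV px.
have mq n : measurable (piece S B' n `&` (iter n S @^-1` A)).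
  by rewrite eq; apply: measurable_preimage => //; apply: measurable_iter.
have -> : induced S B' @^-1` A = \bigcup_n (piece S B' n `&` (iter n S @^-1` A)).
  apply/seteqP; split=> x /=.
    have [n pn] := piece_cover S B' x; rewrite (induced_piece pn) => Ax.
    by exists n.
  by move=> [n _ [pn Ax]]; rewrite (induced_piece pn).
have {2}-> : A = \bigcup_n (piece Si B' n `&` A).
  apply/seteqP; split=> x /=; last by move=> [n _ []].
  by have [n pn] := piece_cover Si B' x; exists n.
rewrite !measure_semi_bigcup //; try exact: bigcupT_measurable.
by apply: eq_eseriesr => n _; rewrite eq preserves_iter.
Qed.

(** * The density estimate for one thinning *)

Section Density.
Context {R : realType} (mu : probability Z R).
Let m (A : set Z) : R := fine (mu A).
Local Open Scope ring_scope.

Let muE A : measurable A -> mu A = (m A)%:E.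
Proof. by move=> mA; rewrite /m fineK // fin_num_measure. Qed.

Let le_m A B : measurable A -> measurable B -> A `<=` B -> m A <= m B.
Proof.
move=> mA mB AB; rewrite -lee_fin -!muE //.
by apply: le_measure; rewrite ?inE.
Qed.

Let m_U A B : measurable A -> measurable B -> m (A `|` B) <= m A + m B.
Proof.
move=> mA mB; rewrite -lee_fin EFinD -!muE //; last exact: measurableU.
exact: measureU2.
Qed.

Let m_disj A B : measurable A -> measurable B -> A `&` B = set0 ->
  m (A `|` B) = m A + m B.
Proof.
move=> mA mB AB; apply: EFin_inj; rewrite EFinD -!muE //; last exact: measurableU.
exact: measureU.
Qed.

(** Let [D k] be the set of points less than [k] past a marker. A point of [B'] outside [D K] is
    sent by [S] into the complement of [B'] in [B], so [m B' <= m B - m B' + m (D K)]. Moreover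
    [m (D K) <= K * m M], while [2 * K * m M = m (D K.*2) <= m B]. *)
Lemma sparse_density B S Si B' : system B S Si -> measurable B' -> B' `<=` B ->
  preserves mu S -> sparse B B' S Si -> 4%:R * fine (mu B') <= 3%:R * fine (mu B).
Proof.
move=> [mB SK SiK mS mSi BS BSi _] mB' BB muS [M [K [mM MB Mdisc hB']]].
have muSi : preserves mu Si by exact: preservesV muS.
pose D k := [set x | exists i, (i < k)%N /\ M (iter i Si x)].
have mMi i : measurable (iter i Si @^-1` M).
  by apply: measurable_preimage => //; apply: measurable_iter.
have mD k : measurable (D k).
  by apply: measurable_ex => i; apply: (@measurable_andP _ _ _ (iter i Si @^-1` M)).
have DS k : D k.+1 = D k `|` (iter k Si @^-1` M).
  apply/seteqP; split=> x /=.
    move=> [i [ik Mi]]; have [ik'|ik'] := ltnP i k; first by left; exists i.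
    by right; rewrite (_ : k = i) //; lia.
  by move=> [[i [ik Mi]]|Mk]; [exists i; split=> //; exact: ltnW | exists k].
have mMk k : m (iter k Si @^-1` M) = m M.
  by rewrite /m preserves_iter.
have D0 : D 0%N = set0 by apply/seteqP; split=> x // [i []].
have leD k : m (D k) <= k%:R * m M.
  elim: k => [|k IH]; first by rewrite D0 /m measure0 mul0r.
  by rewrite DS (le_trans (m_U _ _)) // mMk -natr1 mulrDl mul1r lerD2r.
(* Two markers seen from one point at backward times up to [K.*2] would be at most [K.*2] apart, so
   these translates of [M] are disjoint. *)
have geD k : (k <= K.*2.+1)%N -> m (D k) = k%:R * m M.
  elim: k => [|k IH] kK; first by rewrite D0 /m measure0 mul0r.
  rewrite DS m_disj //; first by rewrite mMk IH ?(ltnW kK) // -natr1 mulrDl mul1r.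
  apply/seteqP; split=> x //= [[i [ik Mi]] Mk].
  apply: (Mdisc (iter k Si x) (k - i)%N) => //; first lia.
  by rewrite can_iter_sub ?leq_subr // subKn // ltnW.
have DB k : D k `<=` B.
  move=> x [i [_ /MB]]; rewrite -{2}(can_iter i SiK x).
  by elim: i (iter i Si x) => //= i IH y /IH; apply: BS.
have h1 : m B' <= m (B `\` B') + m (D K).
  have mBB : measurable (S @^-1` (B `\` B')).
    by apply: measurable_preimage => //; apply: measurableD.
  rewrite [m (B `\` B')](_ : _ = m (S @^-1` (B `\` B'))); last first.
    by rewrite /m muS //; apply: measurableD.
  apply: (le_trans _ (m_U mBB (mD K))); apply: le_m => //; first exact: measurableU.
  by move=> x B'x; case: (hB' x B'x) => h; [left; split=> //; apply/BS/BB | right].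
have h2 : m B = m B' + m (B `\` B').
  rewrite -m_disj //; [by rewrite setDUK | exact: measurableD | by rewrite setDIK].
have h3 := leD K; have h4 := geD _ (leqnSn K.*2).
have h5 : m (D K.*2) <= m B by apply: le_m.
rewrite h4 -muln2 natrM -mulrA (mulrCA K%:R) in h5.
rewrite -/(m B') -/(m B); lra.
Qed.

End Density.
End Induced.

(** * Towers *)

(** Each level is obtained from the previous one by [thinning_exists]; the index shift lets [s k.+1]
    govern the passage from level [k] to level [k.+1]. *)
Record tower d (Z : measurableType d) (s : nat -> seq nat)
    (B : nat -> set Z) (S Si : nat -> Z -> Z) : Prop := Tower {
  tower_system : forall k, system (B k) (S k) (Si k);
  tower_decr : forall k, B k.+1 `<=` B k;
  tower_returns : forall k, returns_in (s k.+1) (B k.+1) (S k);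
  tower_back : forall k x, B k x -> exists i, B k.+1 (iter i (Si k) x);
  tower_sparse : forall k, sparse (B k) (B k.+1) (S k) (Si k);
  towerS : forall k, S k.+1 = induced (S k) (B k.+1);
  towerSi : forall k, Si k.+1 = induced (Si k) (B k.+1) }.

Section TowerMass.
Context {d : measure_display} {Z : measurableType d}.

Lemma returns_in_fwd s (B : set Z) S x :
  returns_in s B S -> B x -> exists n, B (iter n.+1 S x).
Proof. by move=> ret /ret[[|r] [_ // _ Br _]]; exists r. Qed.

Lemma back_bwd (B B' : set Z) S Si x : system B S Si -> B' `<=` B ->
  (forall x, B x -> exists i, B' (iter i Si x)) ->
  B' x -> exists n, B' (iter n.+1 Si x).
Proof.
move=> sys BB back /BB/(system_stableV sys)/back[i Bi].
by exists i; rewrite iterSr.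
Qed.

Lemma tower_exists (B0 : set Z) T Ti (V : nat -> set Z) s : system B0 T Ti -> separating V ->
  (forall k, (0 < k)%N -> [/\ signature (s k), primitive_sig (s k) & ~ trivial_sig (s k)]) ->
  exists B S Si, [/\ tower s B S Si, B 0%N = B0, S 0%N = T & Si 0%N = Ti].
Proof.
move=> sys0 sepV hs.
pose good k (st : set Z * (Z -> Z) * (Z -> Z)) B' := [/\ measurable B', B' `<=` st.1.1,
  returns_in (s k.+1) B' st.1.2, forall x, st.1.1 x -> exists i, B' (iter i st.2 x)
  & sparse st.1.1 B' st.1.2 st.2].
(* [F] is chosen on all triples, with a conclusion only for systems. The recursion [st] is thus
   plain, and [stS] shows afterwards that it stays among systems. *)
have /choice[F FP] : forall p : nat * (set Z * (Z -> Z) * (Z -> Z)), exists B',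
    system p.2.1.1 p.2.1.2 p.2.2 -> good p.1 p.2 B'.
  move=> [k [[B S] Si]]; have [sys|nsys] := pselect (system B S Si); last by exists set0.
  have [s0 s1 st] := hs k.+1 isT.
  by have [B' gB'] := thinning_exists sys sepV s0 s1 st; exists B'.
pose st := fix st k := if k is k'.+1 then
    (F (k', st k'), induced (st k').1.2 (F (k', st k')), induced (st k').2 (F (k', st k')))
  else (B0, T, Ti).
have stS k : system (st k).1.1 (st k).1.2 (st k).2.
  elim: k => [//|k IH] /=.
  have [mB' BB ret back _] := FP (k, st k) IH.
  apply: (induced_system IH) => // x.
    exact: returns_in_fwd ret.
  exact: back_bwd IH BB back.
exists (fun k => (st k).1.1), (fun k => (st k).1.2), (fun k => (st k).2); split=> //.
by split=> // k; case: (FP (k, st k) (stS k)).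
Qed.

Lemma tower_preserves {R : realType} (mu : {measure set Z -> \bar R}%R)
    s (B : nat -> set Z) S Si k :
  tower s B S Si -> preserves mu (S 0%N) -> preserves mu (S k).
Proof.
move=> [sys decr ret back _ SE _] mu0; elim: k => [//|k IH]; rewrite SE.
apply: preserves_induced IH; first exact: sys.
- exact: system_measurable (sys k.+1).
- move=> x; exact: returns_in_fwd (ret k).
- move=> x; exact: back_bwd (sys k) (decr k) (back k).
Qed.

Lemma tower_mass {R : realType} (mu : probability Z R) s (B : nat -> set Z) S Si k :
  tower s B S Si -> preserves mu (S 0%N) -> (fine (mu (B k)) <= (3 / 4) ^+ k)%R.
Proof.
move=> tw mu0; have mB j := system_measurable (tower_system tw j).
elim: k => [|k IH].
  by rewrite expr0 -lee_fin fineK ?fin_num_measure // probability_le1.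
have := sparse_density (tower_system tw k) (mB k.+1) (@tower_decr _ _ _ _ _ _ tw k)
  (tower_preserves k tw mu0) (tower_sparse tw k).
rewrite exprS; move: ((3 / 4) ^+ k)%R IH => c; lra.
Qed.

Lemma tower_bigcap0 {R : realType} (mu : probability Z R) s (B : nat -> set Z) S Si :
  tower s B S Si -> preserves mu (S 0%N) -> mu (\bigcap_k B k) = 0%E.
Proof.
move=> tw mu0; have mB j := system_measurable (tower_system tw j).
have mC : measurable (\bigcap_k B k) by exact: bigcapT_measurable.
have fC : mu (\bigcap_k B k) \is a fin_num by exact: fin_num_measure.
suff c0 : fine (mu (\bigcap_k B k)) = 0%R by rewrite -[LHS]fineK // c0.
apply/eqP; rewrite eq_le fine_ge0 ?measure_ge0 // andbT.
have /cvgr_to_ge : (fun n => (3 / 4 : R) ^+ n)%R @ \oo --> (0 : R^o)%R.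
  by apply: cvg_expr; rewrite ger0_norm; lra.
apply; apply: nearW => n; apply: le_trans (tower_mass n tw mu0).
rewrite fine_le ?fin_num_measure // le_measure ?inE //.
exact: bigcap_inf.
Qed.

End TowerMass.

(** * Blocks *)

Section Blocks.
Context {d : measure_display} {Z : measurableType d}.
Variables (s : nat -> seq nat) (B : nat -> set Z) (S Si : nat -> Z -> Z).
Hypothesis tw : tower s B S Si.

Let sys k : system (B k) (S k) (Si k) := tower_system tw k.
Let SK k : cancel (S k) (Si k) := systemK (sys k).
Let SiK k : cancel (Si k) (S k) := systemVK (sys k).

(* [base k x] is the left end in [B k] of the block of level [k] through [x]. *)
Fixpoint base (k : nat) (x : Z) : Z :=
  if k is k'.+1 then
    iter (first (fun i => B k (iter i (Si k') (base k' x)))) (Si k') (base k' x)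
  else x.

(** The same count as in [base] at level [k.+1]: the rank, from 0, of the level [k] block of [x]
    inside its level [k.+1] block. *)
Definition pos (k : nat) (x : Z) : nat :=
  first (fun i => B k.+1 (iter i (Si k) (base k x))).

Lemma baseS k x : base k.+1 x = iter (pos k x) (Si k) (base k x).
Proof. by []. Qed.

Lemma measurable_pos n k : measurable_fun setT (base k) ->
  measurable [set x | pos k x = n].
Proof.
move=> mb; apply: (@measurable_first _ _ (fun i x => B k.+1 (iter i (Si k) (base k x)))) => i.
apply: (@measurable_preimage _ _ (iter i (Si k) \o base k)).
  exact: (measurableT_comp (measurable_iter i (system_funV (sys k))) mb).
exact: system_measurable (sys k.+1).
Qed.

Lemma measurable_base k : measurable_fun setT (base k).
Proof.
elim: k => [|k IH]; first exact: measurable_id.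
apply: (@measurable_pieces _ _ _ (fun n => [set x | pos k x = n])
  (fun n => iter n (Si k) \o base k)).
- by move=> n; apply: measurable_pos.
- by move=> n; exact: (measurableT_comp (measurable_iter n (system_funV (sys k))) IH).
- by move=> x; exists (pos k x).
- by move=> n x <-.
Qed.

Lemma tower_sub k : B k `<=` B 0%N.
Proof. by elim: k => // k IH x /(tower_decr tw)/IH. Qed.

Lemma base_mem k x : B 0%N x -> B k (base k x).
Proof.
move=> Bx; elim: k => [//|k IH].
by have [] := firstP (tower_back tw IH).
Qed.

(** Each base is a function of the previous one; this makes the partitions coarsen with the
    level. *)
Lemma base_mono k k' x y : (k <= k')%N -> base k x = base k y -> base k' x = base k' y.
Proof.
move=> /subnKC <-; elim: (k' - k)%N => [|m IH] e; first by rewrite addn0.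
by rewrite addnS !baseS /pos (IH e).
Qed.

Definition return_time k b r : Prop :=
  [/\ (0 < r)%N, B k.+1 (iter r (S k) b)
    & forall j, (0 < j < r)%N -> ~ B k.+1 (iter j (S k) b)].

Lemma induced_return k b r : B k.+1 b -> return_time k b r ->
  S k.+1 b = iter r (S k) b.
Proof.
move=> Bb [r0 Br hr]; rewrite (towerS tw) /induced asboolT //.
case: r r0 Br hr => // r _ Br hr; rewrite (@first_eq _ r) // => m mr.
by apply: hr; lia.
Qed.

Lemma return_pos k b r i x : B k.+1 b -> return_time k b r -> (i < r)%N ->
  base k x = iter i (S k) b -> pos k x = i /\ base k.+1 x = b.
Proof.
move=> Bb [r0 Br hr] ir e.
suff pi : pos k x = i by rewrite baseS pi e can_iter.
rewrite /pos e; apply: first_eq; first by rewrite can_iter.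
by move=> m mi; rewrite can_iter_sub ?(ltnW mi) //; apply: hr; lia.
Qed.

(** If the position were at least [r], the walk back to [b] would have met [iter r (S k) b], a point
    of [B k.+1], before stopping. *)
Lemma pos_return k b r x : B 0%N x -> return_time k b r ->
  base k.+1 x = b -> (pos k x < r)%N /\ base k x = iter (pos k x) (S k) b.
Proof.
move=> Bx [r0 Br hr] e; have [_ hp] := firstP (tower_back tw (base_mem k Bx)).
have e' : base k x = iter (pos k x) (S k) b by rewrite -e baseS can_iter.
split=> //; rewrite ltnNge; apply/negP => rp.
apply: (hp (pos k x - r)%N); first by rewrite -/(pos k x); lia.
by rewrite e' can_iter_sub ?leq_subr // subKn.
Qed.

Lemma tower_return k b : B k.+1 b -> exists2 r, r \in s k.+1 & return_time k b r.
Proof. by move=> /(tower_returns tw)[r [rs r0 Br hr]]; exists r. Qed.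

(** Points with the same base at level [k] tie at the added level, so the deciding level is
    unchanged. *)
Lemma induced_ltS k x y : induced_lt pos k x y -> base k x = base k y ->
  induced_lt pos k.+1 x y.
Proof.
move=> [n nk [lt eq]] e; exists n; first exact: ltnW; split=> // j /andP[nj jk].
have [jk'|jk'] := ltnP j k; first by apply: eq; rewrite nj.
by rewrite (_ : j = k) ?/pos ?e //; lia.
Qed.

(* The block [b] of level [k] is the [T]-interval [b, ..., T^(N-1) b], [T = S 0]. *)
Definition block_spec k b N : Prop :=
  [/\ S k b = iter N (S 0%N) b,
    forall x, B 0%N x -> base k x = b <-> exists2 j, (j < N)%N & x = iter j (S 0%N) b
    & forall i j, (i < j < N)%N ->
        induced_lt pos k (iter i (S 0%N) b) (iter j (S 0%N) b)].

(** By induction, a block of level [k.+1] is the concatenation of the [r] blocks of level [k] based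
    at the points [iter i (S k) b], each starting where the previous one ends; [step i] glues the
    first [i] of them. As [r] is at most [sumn (s k.+1)], the bound on the length is uniform in
    [b]. *)
Lemma block_exists k : exists C, forall b, B k b ->
  exists N, [/\ (0 < N)%N, (N <= C)%N & block_spec k b N].
Proof.
elim: k => [|k [C IH]].
  exists 1%N => b Bb; exists 1%N; split=> //; split=> //; last by move=> i j; lia.
  move=> x Bx; split=> [<-|[[|j] // _ ->]//]; by exists 0%N.
exists (sumn (s k.+1) * C)%N => b Bb; have [r rs ret] := tower_return Bb.
have B0 n : B 0%N (iter n (S 0%N) b) by apply: system_iter (sys 0%N) (tower_sub Bb).
have step i : (i <= r)%N -> exists N, [/\ (i <= N)%N, (N <= i * C)%N,
    iter i (S k) b = iter N (S 0%N) b,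
    forall x, B 0%N x -> (exists2 i', (i' < i)%N & base k x = iter i' (S k) b) <->
      exists2 j, (j < N)%N & x = iter j (S 0%N) b
    & forall p q, (p < q < N)%N ->
      induced_lt pos k.+1 (iter p (S 0%N) b) (iter q (S 0%N) b)].
  elim: i => [_|i IHi ir].
    exists 0%N; split=> //; last by move=> p q; lia.
    by move=> x _; split=> -[].
  have [N [iN NC eN memN ltN]] := IHi (ltnW ir).
  pose c := iter i (S k) b.
  have Bc : B k c by apply: system_iter (sys k) (tower_decr tw Bb).
  have [M [M0 MC [eM memM ltM]]] := IH c Bc.
  have cE j : iter j (S 0%N) c = iter (j + N) (S 0%N) b by rewrite /c eN iterD.
  have memc q : (N <= q < N + M)%N -> base k (iter q (S 0%N) b) = c.
    move=> hq; apply/memM => //; exists (q - N)%N; first by lia.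
    by rewrite cE subnK //; lia.
  exists (M + N)%N; split; first by lia.
  - by rewrite mulSn; apply: leq_add.
  - by rewrite iterS -/c eM cE.
  - move=> x Bx; split.
      move=> [i' i'i e]; have [lti|lei] := ltnP i' i.
        have [|j jN ->] := (memN x Bx).1; first by exists i'.
        by exists j => //; lia.
      have ei : i' = i by lia.
      move: e; rewrite ei => /(memM x Bx)[j jM ->].
      by rewrite cE; exists (j + N)%N => //; lia.
    move=> [j jMN ex]; have [jN|jN] := ltnP j N.
      have [|i' i'i e] := (memN x Bx).2; first by exists j.
      by exists i' => //; lia.
    by exists i => //; rewrite ex memc //; lia.
  (* Within the earlier part the order is known; within the new block it is lifted from level [k].
     Across the two it is decided at level [k], where the ranks are some [i' < i] and [i]. *)
  - move=> p q /andP[pq qN]; have [qN'|qN'] := ltnP q N.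
      by apply: ltN; rewrite pq.
    have [pN|pN] := ltnP p N; last first.
      apply: induced_ltS; last by rewrite !memc //; lia.
      have -> : p = (p - N + N)%N by lia.
      have -> : q = (q - N + N)%N by lia.
      by rewrite -!cE; apply: ltM; lia.
    have [|i' i'i e] := (memN _ (B0 p)).2; first by exists p.
    have [pp _] := return_pos Bb ret (ltn_trans i'i ir) e.
    have [|pq' _] := return_pos (x := iter q (S 0%N) b) Bb ret ir.
      by rewrite memc //; lia.
    by exists k => //; rewrite pp pq'; split=> // j; lia.
have [N [rN NC eN memN ltN]] := step r (leqnn r).
have r0 : (0 < r)%N by case: ret.
exists N; split; first by lia.
  apply: leq_trans NC _; rewrite leq_mul2r; apply/orP; right.
  by elim: (s k.+1) rs => //= a l IHl; rewrite inE => /orP[/eqP->|/IHl]; lia.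
split; [by rewrite (induced_return Bb ret) | | exact: ltN].
move=> x Bx; rewrite -memN //; split.
  by move=> /(pos_return Bx ret)[h e]; exists (pos k x).
by move=> [i ir e]; have [] := return_pos Bb ret ir e.
Qed.

(** The block of [S 0 x] is an interval that does not start at this point, so it also contains the
    preceding point [x]. *)
Lemma base_succ k x : B 0%N x -> ~ B k (S 0%N x) -> base k (S 0%N x) = base k x.
Proof.
move=> Bx nB; have BSx := system_stable (sys 0%N) Bx.
have [C /(_ _ (base_mem k BSx))[N [N0 _ [_ memN _]]]] := block_exists k.
have [[|j] jN /= e] := (memN _ BSx).1 erefl.
  by case: nB; rewrite {1}e; apply: base_mem.
apply/esym/memN => //; exists j; first exact: ltnW.
exact: can_inj (SK 0%N) _ _ e.
Qed.

End Blocks.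

(** * Separation *)

(** Two distinct values are separated by some [V i], so the set of disagreement is a countable union
    of Borel sets. With [W] a product, this yields Borel graphs of partitions. *)
Lemma measurable_eq_set d d' (W : measurableType d') (Z : measurableType d)
    (V : nat -> set Z) (f g : W -> Z) : separating V ->
  measurable_fun setT f -> measurable_fun setT g ->
  measurable [set x | f x = g x].
Proof.
move=> [mV sepV] mf mg.
have mpre (h : W -> Z) A : measurable_fun setT h -> measurable A -> measurable (h @^-1` A).
  by move=> mh mA; rewrite -[X in measurable X]setTI; exact: mh.
rewrite (_ : [set x | _] = ~` \bigcup_i (f @^-1` V i `&` ~` (g @^-1` V i))).
  apply/measurableC/bigcupT_measurable => i; apply: measurableI.
    exact: mpre.
  by apply/measurableC/mpre.
apply/seteqP; split => x /=.
  by move=> e [i _ []] /=; rewrite e.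
move=> nV; apply: contrapT => fg; apply: nV.
have [|i [Vf Vg]] := sepV (f x) 1%N (fun _ => g x); first by move=> j _ /esym.
by exists i => //; split=> //; apply: (Vg 0%N).
Qed.

Lemma measurable_aperiodic d (Z : measurableType d) (V : nat -> set Z) (T : Z -> Z) :
  separating V -> measurable_fun setT T -> measurable [set x | ~ periodic_pt T x].
Proof.
move=> sepV mT; apply: (@measurableC _ _ [set x | periodic_pt T x]).
apply: measurable_ex => n; apply: (@measurable_andP _ _ _ [set x | iter n T x = x]).
apply: (@measurable_eq_set _ _ _ _ V (iter n T) id sepV); last exact: measurable_id.
exact: measurable_iter.
Qed.

(** The Hausdorff property gives a neighbourhood of [x] avoiding the finitely many given points; a
    small ball around a point of the dense set fits inside it and contains [x]. *)
Lemma separable_separating (X : pseudoPMetricType RR) : separable_metric X ->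
  exists V : nat -> set (borel X), separating V.
Proof.
move=> [hX [D [/countable_injP[f f_inj] clD]]].
(* As [f] is injective on [D], there is at most one centre. Interiors are taken because balls need
   not be open here. *)
pose W (p : nat * nat) : set X :=
  \bigcup_(a in [set a | D a /\ f a = p.1]) (ball a (p.2.+1%:R^-1)%R)°.
have oW p : open (W p) by apply: bigcup_open => a _; apply: open_interior.
pose V i : set (borel X) := if unpickle i is Some p then W p else set0.
exists V; split.
  move=> i; rewrite /V; case: unpickle => [p|]; last exact: measurable0.
  by apply: sub_sigma_algebra.
move=> x n g gx.
have nbx : nbhs (x : X) [set y : X | forall j, (j < n)%N -> g j <> y].
  elim: n gx => [|n IH] gx; first by apply: filterS filterT => y _ j.
  have h1 := IH (fun j jn => gx j (ltnW jn)).
  have h2 : nbhs (x : X) (~` [set (g n : X)]).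
    apply: open_nbhs_nbhs; split; last by apply/nesym/gx.
    by apply/closed_openC/accessible_closed_set1/hausdorff_accessible.
  apply: filterS2 h1 h2 => y h1 h2 j; rewrite ltnS leq_eqVlt => /orP[/eqP->|/h1//].
  by apply/nesym.
have [e /= e0 xe] := (nbhs_ballP (x : X) _).1 nbx.
have [k ke] : exists k : nat, (k.+1%:R^-1 < e / 2)%R.
  exists (Num.truncn (e / 2)^-1)%R.
  rewrite invf_plt ?posrE ?divr_gt0 ?ltr0n //.
  exact: truncnS_gt.
have k0 : (0 < (k.+1%:R^-1 : RR) / 2)%R by rewrite divr_gt0 ?invr_gt0 ?ltr0n.
have [a [Da xa]] : exists a, D a /\ ball (x : X) (k.+1%:R^-1 / 2)%R a.
  have : closure D x by rewrite clD.
  by move=> /(_ _ (nbhsx_ballx (x : X) _ k0))[a [Da xa]]; exists a.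
exists (pickle (f a, k)); rewrite /V pickleK /W; split.
  exists a => //=; apply: filterS (nbhsx_ballx (x : X) _ k0) => y xy.
  by apply: (ball_splitr xa).
move=> j jn [a' [Da' /= fa]] /interior_subset; have -> : a' = a by apply: f_inj; rewrite ?inE.
move=> ag; apply: (xe (g j) _ j jn erefl); rewrite /= -/(ball _ _ _).
(* With [u] the radius, [a] is within [u / 2] of [x] and [g j] within [u] of [a]; since [u < e / 2],
   the sum is below [e]. *)
apply: (@le_ball _ _ x (k.+1%:R^-1 / 2 + k.+1%:R^-1)%R).
  by move: ke k0; set u : RR := (_^-1)%R; move: u e {e0 xe} => u e; lra.
exact: (ball_triangle xa ag).
Qed.

(** * The filtration *)

Section Elements.
Context {d : measure_display} {Z : measurableType d}.
Variables (s : nat -> seq nat) (B : nat -> set Z) (S Si : nat -> Z -> Z).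
Hypothesis tw : tower s B S Si.
Variable Y : set Z.
Hypothesis YB : Y `<=` B 0%N.
Hypothesis YS : forall x, Y x -> Y (S 0%N x).
Hypothesis YSi : forall x, Y x -> Y (Si 0%N x).

Let T := S 0%N.
Let Ti := Si 0%N.
Let TK : cancel T Ti := systemK (tower_system tw 0).
Let TiK : cancel Ti T := systemVK (tower_system tw 0).

Definition block k x : set Z := [set y | Y y /\ base B Si k y = base B Si k x].

Let YT n x : Y x -> Y (iter n T x).
Proof. by move=> Yx; elim: n => //= n; apply: YS. Qed.

Let YTi n x : Y x -> Y (iter n Ti x).
Proof. by move=> Yx; elim: n => //= n; apply: YSi. Qed.

Lemma base_in k x : Y x -> Y (base B Si k x).
Proof.
move=> Yx; have [C hC] := block_exists tw k.
have [N [N0 _ [_ memN _]]] := hC _ (base_mem tw k (YB Yx)).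
have [j jN e] := (memN x (YB Yx)).1 erefl.
by rewrite -(can_iter j TK (base B Si k x)) -e; apply: YTi.
Qed.

Lemma block_interval k : exists C, forall x, Y x -> exists a N, [/\ (N <= C)%N,
  block k x = [set iter j T a | j in `I_N]
  & forall i j, (i < j < N)%N -> induced_lt (pos B Si) k (iter i T a) (iter j T a)].
Proof.
have [C hC] := block_exists tw k; exists C => x Yx.
have [N [N0 NC [_ memN ltN]]] := hC _ (base_mem tw k (YB Yx)).
exists (base B Si k x), N; split=> //.
have Ya : Y (base B Si k x) := base_in k Yx.
apply/seteqP; split=> y.
  by move=> [Yy] /(memN y (YB Yy))[j jN ->]; exists j.
move=> [j jN <-]; have Yj := YT j Ya; split=> //.
by apply/(memN _ (YB Yj)); exists j.
Qed.

Lemma iter_tower k n b : Y b -> B k b -> Y (iter n (S k) b).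
Proof.
move=> Yb Bb; elim: n => [//|n IH] /=.
have Bn : B k (iter n (S k) b) by apply: system_iter (tower_system tw k) Bb.
have [C hC] := block_exists tw k; have [N [_ _ [-> _ _]]] := hC _ Bn.
exact: YT.
Qed.

Lemma base_id k b : B k b -> base B Si k b = b.
Proof.
move=> Bb; have [C hC] := block_exists tw k; have [N [N0 _ [_ memN _]]] := hC _ Bb.
by apply/(memN b (tower_sub tw Bb)); exists 0%N.
Qed.

(** The blocks of level [k] that compose the block based at [b] are based at [iter i (S k) b] for
    [i < r], where [r] is the return time of [b] to [B k.+1]; they are distinct because [pos]
    recovers [i]. *)
Lemma quotient_block k x : Y x -> exists r, [/\ r \in s k.+1,
  quotient_elt block k x #= `I_r & forall y, block k.+1 x y -> (pos B Si k y < r)%N].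
Proof.
move=> Yx; set b := base B Si k.+1 x.
have Bb : B k.+1 b by apply: base_mem tw _ _ (YB Yx).
have Bkb := tower_decr tw Bb; have Yb : Y b := base_in k.+1 Yx.
have [r rs ret] := tower_return tw Bb.
have posr y : block k.+1 x y -> (pos B Si k y < r)%N /\
    base B Si k y = iter (pos B Si k y) (S k) b.
  by move=> [Yy e]; apply: (pos_return tw (YB Yy) ret).
exists r; split=> //; last by move=> y /posr[].
have baseE i : base B Si k (iter i (S k) b) = iter i (S k) b.
  by apply: base_id; apply: system_iter (tower_system tw k) Bkb.
have -> : quotient_elt block k x = (fun i => block k (iter i (S k) b)) @` `I_r.
  apply/seteqP; split=> A /=.
    move=> [y /posr[pr e] <-]; exists (pos B Si k y) => //.
    by rewrite /block baseE e.
  move=> [i ir <-]; exists (iter i (S k) b) => //; split; first exact: iter_tower.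
  by have [] := return_pos tw Bb ret ir (baseE i).
apply: inj_card_eq => i j; rewrite !inE /= => ir jr e.
have : block k (iter j (S k) b) (iter i (S k) b).
  by rewrite -e; split=> //; apply: iter_tower.
move=> [_]; rewrite !baseE => eij.
have [<- _] := return_pos tw Bb ret ir (baseE i).
by have [<- _] := return_pos tw Bb ret jr (baseE j); rewrite eij.
Qed.

(** A point and its image share a block at any level [l] where the image is outside [B l], and such
    a level exists. Finitely many steps are joined at the maximal level; backward iterates are
    reached by starting from them and moving forward to [x]. *)
Lemma block_orbit x : (forall y, Y y -> ~ (\bigcap_k B k) y) -> Y x ->
  \bigcup_k block k x = T_orbit T Ti x.
Proof.
move=> noB Yx.
have fwd j z : Y z -> exists k, base B Si k (iter j T z) = base B Si k z.
  move=> Yz; elim: j => [|j [k IH]]; first by exists 0%N.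
  have Yj := YT j Yz.
  have /existsNP[l /not_implyP[_ nBl]] := noB _ (YS Yj).
  exists (maxn k l); rewrite -(base_mono (leq_maxl k l) IH).
  exact: base_mono (leq_maxr k l) (base_succ tw (YB Yj) nBl).
apply/seteqP; split=> y.
  move=> [k _ h]; have [C /(_ x Yx)[a [N [_ E _]]]] := block_interval k.
  have hx : block k x x by split.
  move: h hx; rewrite E => -[j _ <-] [i _ <-].
  have [ij|ij] := leqP i j.
    by exists (j - i)%N; left; rewrite -iterD subnK.
  by exists (i - j)%N; right; rewrite can_iter_sub ?leq_subr // subKn // ltnW.
move=> [j [->|->]].
  by have [k e] := fwd j x Yx; exists k => //; split=> //; apply: YT.
have [k] := fwd j _ (YTi j Yx); rewrite can_iter // => e.
by exists k => //; split=> //; apply: YTi.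
Qed.

Lemma pos_block k x y z : base B Si k.+1 y = base B Si k.+1 x ->
  base B Si k.+1 z = base B Si k.+1 x -> pos B Si k y = pos B Si k z ->
  block k y = block k z.
Proof.
move=> ey ez epos; rewrite /block; suff -> : base B Si k y = base B Si k z by [].
apply: (can_inj (can_iter (pos B Si k y) (systemVK (tower_system tw k)))).
by rewrite -baseS epos -baseS ey ez.
Qed.

End Elements.

(** * Universality of the domain and verification of the filtration *)

Theorem theorem2 (s : nat -> seq nat)
  (hs : forall k, (0 < k)%N ->
     [/\ signature (s k), primitive_sig (s k) & ~ trivial_sig (s k)])
  (X : pseudoPMetricType RR) (hX : separable_metric X)
  (T Tinv : X -> X) (hT : borel_automorphism T Tinv) :
  exists (Xh : set X) (xi : nat -> X -> set X) (pos : nat -> X -> nat),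
    [/\ metrically_universal T Xh,
        T @^-1` Xh = Xh,
        (forall x, Xh x -> ~ periodic_pt T x),
        basic_filtration_for Xh T Tinv xi pos
      & forall k, (1 <= k)%N -> subordinate Xh xi k (s k)].
Proof.
have [TK [TiK [mT mTi]]] := hT.
have [V sepV] := separable_separating hX.
pose A0 : set (borel X) := [set x | ~ periodic_pt T x].
have mA0 : measurable A0 by exact: measurable_aperiodic sepV mT.
have sys0 : @system _ (borel X) A0 T Tinv.
  split=> //.
  - move=> x nx [n [n0 e]]; apply: nx; exists n; split=> //.
    by apply: (can_inj TK); rewrite -iterS iterSr.
  - move=> x nx [n [n0 e]]; apply: nx; exists n; split=> //.
    by rewrite -{1}(TiK x) -iterSr iterS e TiK.
  - by move=> n x nx e; apply: nx; exists n.+1.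
have [B [S [Si [tw B0 S0 Si0]]]] := tower_exists sys0 sepV hs.
pose C : set (borel X) := \bigcap_k B k.
have mC : measurable C.
  by apply: bigcapT_measurable => k; exact: system_measurable (tower_system tw k).
(* Removing the whole orbit saturation of [C], in both directions, keeps the domain invariant. *)
pose Xh : set (borel X) :=
  A0 `&` [set x | forall j, ~ C (iter j T x) /\ ~ C (iter j Tinv x)].
have mTC j : measurable (iter j T @^-1` C : set (borel X)).
  exact: (measurable_preimage (measurable_iter j mT)).
have mTiC j : measurable (iter j Tinv @^-1` C : set (borel X)).
  exact: (measurable_preimage (measurable_iter j mTi)).
have mXh : measurable Xh.
  apply: measurableI => //; apply: measurable_all => j.
  exact: (measurableI _ _ (measurableC (mTC j)) (measurableC (mTiC j))).
have XhT x : Xh x -> Xh (T x).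
  move=> [Ax Cx]; split; first exact: (system_stable sys0).
  move=> j; split; first by rewrite -iterSr; apply: (Cx j.+1).1.
  by case: j => [|j]; [apply: (Cx 1%N).1 | rewrite iterSr TK; apply: (Cx j).2].
have XhTi x : Xh x -> Xh (Tinv x).
  move=> [Ax Cx]; split; first exact: (system_stableV sys0).
  move=> j; split; last by rewrite -iterSr; apply: (Cx j.+1).2.
  by case: j => [|j]; [apply: (Cx 1%N).2 | rewrite iterSr TiK; apply: (Cx j).1].
have XhB : Xh `<=` B 0%N by rewrite B0 => x [].
have XhC x : Xh x -> ~ C x by move=> [_ /(_ 0%N)[]].
have YS x : Xh x -> Xh (S 0%N x) by rewrite S0; exact: XhT.
have YSi x : Xh x -> Xh (Si 0%N x) by rewrite Si0; exact: XhTi.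
exists Xh, (block B Si Xh), (pos B Si); split.
- split=> // mu [muT muper].
  have mu0 : preserves mu (S 0%N) by rewrite S0.
  have muT' : preserves mu T by [].
  have muTi : preserves mu Tinv := @preservesV _ (borel X) _ mu T Tinv TK mTi muT'.
  have C0 : mu C = 0%E := tower_bigcap0 tw mu0.
  have nXh : mu (~` Xh) = 0%E.
    (* The complement of [Xh] is covered by the periodic points and countably many preimages of the
       null set [C] under powers of [T] and [Tinv]. *)
    have null : mu.-negligible ([set x | periodic_pt T x] `|`
        \bigcup_j ((iter j T @^-1` C) `|` (iter j Tinv @^-1` C))).
      apply: negligibleU.
        apply/negligibleP => //; rewrite -(setCK [set x | periodic_pt T x]).
        exact: measurableC.
      apply: negligible_bigcup => j; apply: negligibleU; apply/negligibleP => //.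
        exact: (etrans (preserves_iter j mT muT' mC) C0).
      exact: (etrans (preserves_iter j mTi muTi mC) C0).
    apply/(negligibleP mu (measurableC mXh)); apply: negligibleS null.
    move=> x /not_andP[/contrapT per|/existsNP[j /not_andP[]/contrapT h]].
    + by left.
    + by right; exists j => //; left.
    + by right; exists j => //; right.
  have := probability_setC mu (measurableC mXh).
  by rewrite setCK nXh sube0.
- apply/seteqP; split=> x; last exact: XhT.
  by move=> /XhTi; rewrite TK.
- by move=> x [].
- split; [split|split].
  + split; last split.
    * move=> n; split.
        move=> x Yx; split; [by split | by move=> y [] |].
        by move=> y [_ e]; rewrite /block e.
      rewrite (_ : [set p | _] = (fst @^-1` Xh `&` snd @^-1` Xh) `&`
          [set p | base B Si n p.2 = base B Si n p.1]).
        apply: measurableI; first apply: measurableI.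
        - by rewrite -[X in measurable X]setTI; apply: measurable_fst.
        - by rewrite -[X in measurable X]setTI; apply: measurable_snd.
        - apply: (measurable_eq_set sepV).
            exact: (measurableT_comp (measurable_base tw n) measurable_snd).
          exact: (measurableT_comp (measurable_base tw n) measurable_fst).
      by apply/seteqP; split=> p /=; [move=> [? []] | move=> [[]]].
    * move=> x Yx; apply/seteqP; split=> y /=; first by case.
      by move=> ->.
    * by move=> n x Yx y [Yy e]; split=> //; apply: base_mono (leqnSn n) e.
  + move=> n; have [N hN] := block_interval tw XhB YS YSi n; exists N => x Yx.
    have [a [M [MN -> _]]] := hN x Yx.
    by apply: card_le_trans (card_image_le _ _) _; rewrite card_le_II.
  + move=> n; split.
    * by move=> x y Yx [_ e]; rewrite /pos e.
    * move=> x y z Yx [_ ey] [_ ez]; exact: (pos_block tw Xh ey ez).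
    * move=> x Yx; have [r [_ qr pr]] := quotient_block tw XhB YS YSi n Yx.
      by exists r.
    * move=> i; apply: (@measurableI _ (borel X) Xh) => //.
      exact: (measurable_pos tw i (measurable_base tw n)).
  + move=> k x Yx; have [N hN] := block_interval tw XhB YS YSi k.
    have [a [M [_ E lt]]] := hN x Yx.
    by exists a, M; rewrite -S0.
  + by move=> x Yx; rewrite -S0 -Si0; exact: (block_orbit tw XhB YS YSi XhC Yx).
- move=> [//|k] _ x Yx; have [r [rs qr _]] := quotient_block tw XhB YS YSi k Yx.
  by exists r.
Qed.
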